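(* There exists a universal constant $K>0$ such that the following holds. Let $N$ be a positive integer, let $\mathbf A=[a_{ij}]\in\mathbb R^{N\times N}$, and let $\mathbf C=[c_{ij}]\in\mathbb R^{N\times N}$ be doubly centered with zero diagonal entries. Let $\pi$ be uniformly distributed over $\mathcal S_N$ and put $Q_{\mathsf{QF}}:=\sum_{i,j\in[N]}c_{ij}\,a_{\pi(i)\pi(j)}$. Then for every $t\ge 0$, $$\mathrm P\big(Q_{\mathsf{QF}}-\mathrm E[Q_{\mathsf{QF}}]\ge t\big)\le\exp\Big\{-\frac{t}{K\nu}\log\Big(1+\frac{N\nu t}{K\|\mathbf C\|_{\mathsf{op}}^2\|\mathbf A\|_{\mathsf F}^2}\Big)\Big\},$$ where $$\nu:=\max_{\substack{i,j\in[N]\\ \sigma,\tilde\sigma\in\mathcal S_N}}\Big|\sum_{k=1}^{\lfloor N/2\rfloor}c_{i\sigma(k)}\,a_{j\tilde\sigma(k)}\Big|.$$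
   Context: $[N]=\{1,\dots,N\}$ and $\mathcal S_N$ is the group of permutations of $[N]$. The matrices $\mathbf A,\mathbf C$ are fixed (deterministic). A matrix $\mathbf C=[c_{ij}]$ is doubly centered if $\sum_{i=1}^N c_{ik}=\sum_{j=1}^N c_{kj}=0$ for all $k\in[N]$. $\|\cdot\|_{\mathsf{op}}$ is the spectral (operator) norm and $\|\cdot\|_{\mathsf F}$ the Frobenius norm. $\lfloor\cdot\rfloor$ is the floor function. ''Universal constant'' means that $K$ does not depend on $N,\mathbf A,\mathbf C,t$. *)

(* Defs.v *)
From HB Require Import structures.
From mathcomp Require Import all_boot all_order all_algebra all_fingroup.
From mathcomp Require Import all_classical all_reals all_analysis.
Set Implicit Arguments.
Unset Strict Implicit.
Unset Printing Implicit Defensive.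
Import Order.TTheory GRing.Theory Num.Theory.
Import numFieldNormedType.Exports.
Local Open Scope classical_set_scope.
Local Open Scope ring_scope.

Definition doubly_centered (R : realType) (N : nat) (C : 'M[R]_N) : Prop :=
  forall k : 'I_N, \sum_(i < N) C i k = 0 /\ \sum_(j < N) C k j = 0.

(* On column vectors this is the Euclidean norm. *)
Definition frob_norm (R : realType) (m n : nat) (A : 'M[R]_(m, n)) : R :=
  Num.sqrt (\sum_(i < m) \sum_(j < n) A i j ^+ 2).

Definition op_norm (R : realType) (m n : nat) (A : 'M[R]_(m, n)) : R :=
  sup [set frob_norm (A *m x) | x in [set x : 'cV[R]_n | frob_norm x <= 1]].

(* [pi] is a random variable with values in the finite set of permutations
   (with its discrete sigma-algebra), uniformly distributed. *)
Definition uniform_perm (d : measure_display) (T : measurableType d)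
    (R : realType) (P : probability T R) (N : nat) (pi : T -> 'S_N) : Prop :=
  forall s : 'S_N, measurable (pi @^-1` [set s]) /\
                   P (pi @^-1` [set s]) = ((N`!%:R)^-1)%:E.

Definition perm_form (R : realType) (N : nat) (A C : 'M[R]_N) (s : 'S_N) : R :=
  \sum_(i < N) \sum_(j < N) C i j * A (s i) (s j).

(* Ordinals start at 0, so k = 1, ..., floor(N/2) becomes k < N./2.  The
   default 0 of the maximum is harmless: the terms are nonnegative. *)
Definition half_max (R : realType) (N : nat) (A C : 'M[R]_N) : R :=
  \big[Num.max/0]_(i < N) \big[Num.max/0]_(j < N)
    \big[Num.max/0]_(s : 'S_N) \big[Num.max/0]_(s' : 'S_N)
      `| \sum_(k < N | (k < N./2)%N) C i (s k) * A j (s' k) |.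

(* exp(- t / (K nu) * log(1 + N nu t / (K V))), where V stands for
   ||C||_op^2 ||A||_F^2.  Since x / 0 = 0 here, the formula taken literally
   would give the vacuous bound 1 for nu = 0; the degenerate cases therefore
   get their limit values: for V = 0 the bound is 0 if t > 0 and 1 if t = 0,
   and for nu = 0 < V it is the limit as nu -> 0+. *)
Definition bennett_bound (R : realType) (K : R) (N : nat) (nu V t : R) : R :=
  if V == 0 then (t == 0)%:R
  else if nu == 0 then expR (- (N%:R * t ^+ 2 / (K ^+ 2 * V)))
  else expR (- (t / (K * nu) * ln (1 + N%:R * nu * t / (K * V)))).

(* Main.v *)
(* Fix disjoint pairs (p_k, q_k) of positions and a set B of N/2 further
   positions, and let S(pi) be the sum over k of
     D_k(pi) = sum_{j in B} (c_{p_k j} - c_{q_k j}) (a_{pi(p_k) pi(j)} - a_{pi(q_k) pi(j)}).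
   Zero diagonal and zero column sums make Q exactly a bounded multiple of the
   average of S over all relabellings of the positions, so by Jensen it is
   enough to bound E exp(theta S).  Swapping pi(p_k) and pi(q_k) flips the sign
   of D_k alone, which turns each exp into a cosh, and cosh(x - y) <=
   cosh(2x) cosh(2y) separates the pair.  The values of pi at the paired
   positions are then averaged out one at a time over the positions outside B,
   enough spare positions being kept for every average to run over at least
   N/8 of them.  What remains is controlled by |sum_{j in B} c_ij a_{l pi(j)}|
   <= nu and by the sum over i and l of these squares, which is at most
   ||C||_op^2 ||A||_F^2.  Chernoff's bound concludes. *)

Require Import Defs.
From HB Require Import structures.
From mathcomp Require Import all_boot all_order all_algebra all_fingroup.
From mathcomp Require Import all_classical all_reals all_analysis.
From mathcomp Require Import measurable_realfun zify ring lra.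
Set Implicit Arguments.
Unset Strict Implicit.
Unset Printing Implicit Defensive.
Import Order.TTheory GRing.Theory Num.Theory.
Import numFieldNormedType.Exports.
Local Open Scope classical_set_scope.
Local Open Scope ring_scope.

(** * Elementary inequalities for the hyperbolic cosine *)

Section HyperbolicCosine.
Variable R : realType.
Implicit Types x y : R.

Definition cosh x : R := (expR x + expR (- x)) / 2.

Lemma coshN x : cosh (- x) = cosh x.
Proof. by rewrite /cosh opprK addrC. Qed.

Lemma cosh_gt0 x : 0 < cosh x.
Proof. by rewrite divr_gt0// addr_gt0// expR_gt0. Qed.

Lemma cosh_ge1 x : 1 <= cosh x.
Proof. by rewrite /cosh; have := expR_ge1Dx x; have := expR_ge1Dx (- x); lra. Qed.

(** By AM-GM, [cosh (x - y)] is at most the mean of [cosh (2 * x)] and [cosh (2 * y)]; the mean of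
    two numbers that are at least 1 is at most their product. *)
Lemma cosh_sub_le x y : cosh (x - y) <= cosh (2 * x) * cosh (2 * y).
Proof.
suff h : cosh (x - y) <= (cosh (2 * x) + cosh (2 * y)) / 2.
  by have := cosh_ge1 (2 * x); have := cosh_ge1 (2 * y); nra.
have dbl z : cosh (2 * z) = (expR z ^+ 2 + expR (- z) ^+ 2) / 2.
  by rewrite /cosh -mulrN !expRM_natl.
rewrite !dbl /cosh opprB !expRD.
have := sqr_ge0 (expR x - expR (- y)); have := sqr_ge0 (expR y - expR (- x)).
lra.
Qed.

Lemma cosh_sub1_le x z : `|x| <= z -> cosh x - 1 <= x ^+ 2 / 2 * expR z.
Proof.
wlog x0 : x / 0 <= x.
  move=> h; case: (leP 0 x) => [|/ltW] x0 xz; first exact: h.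
  by rewrite -coshN -sqrrN h ?oppr_ge0 ?normrN.
rewrite ger0_norm// => xz.
(* [cosh x - 1 = 2 sinh(x/2)^2] and [2 sinh(x/2) = e^(x/2) (1 - e^(-x)) <= x e^(x/2)]. *)
set a := expR (x / 2); set b := expR (- (x / 2)).
have ab : a * b = 1 by rewrite expRxMexpNx_1.
have -> : cosh x - 1 = (a - b) ^+ 2 / 2.
  have -> : cosh x = (a * a + b * b) / 2.
    by rewrite /a /b -!expRD -opprD -splitr.
  by field: ab.
have h : a - b <= x * a.
  have -> : a - b = a * (1 - b * b) by rewrite mulrBr mulr1 mulrA ab mul1r.
  rewrite [x * a]mulrC ler_pM2l ?expR_gt0// /b -expRD -opprD -splitr.
  by have := expR_ge1Dx (- x); lra.
have h0 : 0 <= a - b by rewrite subr_ge0 ler_expR; lra.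
have ha : a * a <= expR z by rewrite /a -expRD -splitr ler_expR.
have : (a - b) ^+ 2 <= (x * a) ^+ 2 by rewrite ler_sqr// nnegrE mulr_ge0// expR_ge0.
by have := sqr_ge0 x; rewrite exprMn expr2; nra.
Qed.

(** Serves at [x = L / 2] with [expR L = 1 + y], to justify the choice of the Chernoff parameter. *)
Lemma mul_expR_le x : 0 <= x -> x * expR x <= expR (2 * x) - 1.
Proof.
move=> x0; rewrite expRM_natl.
by have := expR_ge1Dx x; nra.
Qed.

End HyperbolicCosine.

(** * Resampling the values of a uniform permutation *)

Section Resampling.
Variables (R : realType) (T : finType).
Implicit Types (s : {perm T}) (A : {set T}).

Lemma sum_perm_mull (t : {perm T}) (F : {perm T} -> R) :
  \sum_s F s = \sum_s F (t * s)%g.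
Proof. by rewrite (reindex_inj (mulgI t)). Qed.

(** Composition with [tperm i j] is a bijection of the permutations that exchanges the values at [i]
    and [j], so every [j] in [A] gives the same sum. *)
Lemma resample A (i : T) (F : {perm T} -> T -> R) :
    (forall j s l, j \in A -> F (tperm i j * s)%g l = F s l) ->
  #|A|%:R * \sum_s F s (s i) = \sum_s \sum_(j in A) F s (s j).
Proof.
move=> FA; rewrite exchange_big/= mulr_natl -sumr_const; apply: eq_bigr => j jA.
rewrite (sum_perm_mull (tperm i j)); apply: eq_bigr => s _.
by rewrite FA// permM tpermL.
Qed.

(* Positions are resampled one at a time, each among the positions of [A] not
   yet treated; the slack in [size ks + m <= #|A| + 1] keeps at least [m] of
   them available throughout. *)
Lemma expose (K : eqType) (pos : K -> T) A (f : K -> {perm T} -> T -> R)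
    (m : nat) (ks : seq K) (g : {perm T} -> R) :
    (0 < m)%N -> (forall k s l, 0 <= f k s l) ->
    (forall k s l i j, i \in A -> j \in A -> f k (tperm i j * s)%g l = f k s l) ->
    (forall s, 0 <= g s) ->
    (forall s i j, i \in A -> j \in A -> g (tperm i j * s)%g = g s) ->
    uniq (map pos ks) -> all (mem A) (map pos ks) ->
    (size ks + m <= #|A| + 1)%N ->
  \sum_s g s * \prod_(k <- ks) (1 + f k s (s (pos k))) <=
  \sum_s g s * \prod_(k <- ks) (1 + m%:R^-1 * \sum_(j in A) f k s (s j)).
Proof.
move=> m0 f0 fA; elim: ks g => [|k ks IH] g g0 gA /=.
  by move=> _ _ _; apply: ler_sum => s _; rewrite !big_nil.
case/andP=> kks uks /andP[kA ksA] sz.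
pose avg s := m%:R^-1 * \sum_(j in A) f k s (s j).
have avg0 s : 0 <= avg s by rewrite mulr_ge0 ?invr_ge0// sumr_ge0.
have avgA s i j : i \in A -> j \in A -> avg (tperm i j * s)%g = avg s.
  move=> iA jA; rewrite /avg (reindex_inj (@perm_inj _ (tperm i j)))/=; congr *%R.
  apply: eq_big => [l|l _]; last by rewrite fA// permM tpermK.
  by case: tpermP => // ->; rewrite ?iA ?jA.
(* The positions still in [ks] are left out because the remaining factors of [G] read the values
   there; swapping [pos k] with a position of [A'] does not change [G]. *)
pose A' := A :\: [set x in map pos ks].
have cA' : (m <= #|A'|)%N.
  have : (#|A| <= #|A'| + size ks)%N.
    rewrite -(cardsID [set x in map pos ks] A) addnC leq_add2l.
    apply: leq_trans (subset_leq_card (finset.subsetIr _ _)) _.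
    by rewrite cardsE (leq_trans (card_size _))// size_map.
  by move: sz; lia.
pose G s := g s * \prod_(k' <- ks) (1 + f k' s (s (pos k'))).
have G0 s : 0 <= G s by rewrite mulr_ge0// prodr_ge0// => ? _; rewrite addr_ge0.
have kA' : pos k \in A' by rewrite !inE kks kA.
have GA' j s : j \in A' -> G (tperm (pos k) j * s)%g = G s.
  rewrite !inE => /andP[jks jA]; rewrite /G gA//; congr *%R.
  rewrite !big_seq; apply: eq_bigr => k' k'ks; rewrite fA// permM tpermD//.
    by apply: contraNneq kks => ->; apply: map_f.
  by apply: contraNneq jks => ->; apply: map_f.
have step : \sum_s G s * f k s (s (pos k)) <= \sum_s G s * avg s.
  have c0 : (0 : R) < #|A'|%:R by rewrite ltr0n (leq_trans m0).
  rewrite -(ler_pM2l c0) (@resample A' (pos k) (fun s l => G s * f k s l)); last first.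
    by move=> j s l jA'; rewrite GA'// fA//; move: jA'; rewrite inE => /andP[].
  rewrite mulr_sumr; apply: ler_sum => s _; rewrite -mulr_sumr mulrCA ler_wpM2l//.
  (* Enlarging the sum from [A'] to [A] makes the average invariant under all swaps within [A], so
     that it can join [g] in the induction. *)
  rewrite /avg mulrA; apply: (@le_trans _ _ (\sum_(j in A) f k s (s j))).
    rewrite [leRHS](bigID (mem A'))/= [leLHS](_ : _ = \sum_(j in A | j \in A') f k s (s j)).
      by rewrite lerDl sumr_ge0.
    by apply: eq_bigl => j; rewrite !inE; case: (j \in A); rewrite ?andbF.
  rewrite ler_peMl ?sumr_ge0//.
  by rewrite ler_pdivlMr ?ltr0n// mul1r ler_nat.
apply: (@le_trans _ _ (\sum_s (g s * (1 + avg s)) *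
    \prod_(k' <- ks) (1 + f k' s (s (pos k'))))).
  rewrite [leLHS](_ : _ = \sum_s G s + \sum_s G s * f k s (s (pos k))).
    rewrite [leRHS](_ : _ = \sum_s G s + \sum_s G s * avg s) ?lerD2l//.
    by rewrite -big_split/=; apply: eq_bigr => s _; rewrite /G; ring.
  by rewrite -big_split/=; apply: eq_bigr => s _; rewrite big_cons /G; ring.
apply: le_trans (IH _ _ _ uks ksA _) _.
- by move=> s; rewrite mulr_ge0// addr_ge0.
- by move=> s i j iA jA; rewrite gA// avgA.
- by move: sz; lia.
- by apply: ler_sum => s _; rewrite big_cons -/(avg s) mulrA.
Qed.

(** Applying [tau k] changes only the sign of the exponent of [k]; averaging the two forms of the
    sum gives [cosh]. Factors already treated are collected in [g]. *)
Lemma symmetrize (K : eqType) (tau : K -> {perm T}) (D : K -> {perm T} -> R)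
    (ks : seq K) (g : {perm T} -> R) :
    (forall k s, D k (tau k * s)%g = - D k s) ->
    (forall k k' s, k != k' -> D k (tau k' * s)%g = D k s) ->
    (forall k s, k \in ks -> g (tau k * s)%g = g s) -> uniq ks ->
  \sum_s g s * \prod_(k <- ks) expR (D k s) =
  \sum_s g s * \prod_(k <- ks) cosh (D k s).
Proof.
move=> DN Dk; elim: ks g => [|k ks IH] g gt /=.
  by move=> _; apply: eq_bigr => s _; rewrite !big_nil.
case/andP=> kks uks.
pose G s := g s * \prod_(k' <- ks) expR (D k' s).
have Gt s : G (tau k * s)%g = G s.
  rewrite /G gt ?mem_head//; congr *%R; rewrite !big_seq; apply: eq_bigr => k' k'ks.
  by rewrite Dk//; apply: contraNneq kks => <-.
transitivity (\sum_s G s * expR (D k s)).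
  by apply: eq_bigr => s _; rewrite big_cons /G; ring.
transitivity (\sum_s G s * cosh (D k s)).
  have h : \sum_s G s * expR (D k s) = \sum_s G s * expR (- D k s).
    by rewrite (sum_perm_mull (tau k)); apply: eq_bigr => s _; rewrite Gt DN.
  rewrite /cosh; under [RHS]eq_bigr do rewrite mulrA mulrDr.
  by rewrite -mulr_suml big_split/= -h; field.
transitivity (\sum_s (g s * cosh (D k s)) * \prod_(k' <- ks) expR (D k' s)).
  by apply: eq_bigr => s _; rewrite /G mulrAC.
rewrite IH//.
  by apply: eq_bigr => s _; rewrite big_cons mulrA.
move=> k' s k'ks; rewrite gt ?inE ?k'ks ?orbT//.
by rewrite Dk//; apply: contraNneq kks => ->.
Qed.

End Resampling.

(** * Frobenius and operator norms, and Jensen's inequality *)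

Section Norms.
Variable R : realType.

Lemma frob_norm_sqr m n (A : 'M[R]_(m, n)) :
  frob_norm A ^+ 2 = \sum_(i < m) \sum_(j < n) A i j ^+ 2.
Proof.
by rewrite sqr_sqrtr// sumr_ge0// => i _; rewrite sumr_ge0// => j _; rewrite sqr_ge0.
Qed.

Lemma frob_norm_ge0 m n (A : 'M[R]_(m, n)) : 0 <= frob_norm A.
Proof. exact: sqrtr_ge0. Qed.

Lemma frob_norm_cV m (x : 'cV[R]_m) : frob_norm x ^+ 2 = \sum_(i < m) x i ord0 ^+ 2.
Proof. by rewrite frob_norm_sqr; apply: eq_bigr => i _; rewrite big_ord1. Qed.

Lemma frob_normZ m n (a : R) (A : 'M[R]_(m, n)) :
  0 <= a -> frob_norm (a *: A) = a * frob_norm A.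
Proof.
move=> a0; apply/eqP; rewrite -(@eqrXn2 _ 2) ?mulr_ge0 ?frob_norm_ge0//.
rewrite exprMn !frob_norm_sqr mulr_sumr; apply/eqP; apply: eq_bigr => i _.
by rewrite mulr_sumr; apply: eq_bigr => j _; rewrite mxE exprMn.
Qed.

Lemma frob_norm0 m n : frob_norm (0 : 'M[R]_(m, n)) = 0.
Proof. by rewrite -(scale0r (0 : 'M[R]_(m, n))) frob_normZ// mul0r. Qed.

(** Ensures that the [sup] in [op_norm] is a true supremum. Entries of a vector in the unit ball are
    at most 1 in absolute value, so the absolute row sums of [A] give an upper bound. *)
Lemma op_norm_has_sup m n (A : 'M[R]_(m, n)) :
  has_sup [set frob_norm (A *m x) | x in [set x : 'cV[R]_n | frob_norm x <= 1]].
Proof.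
split.
  by exists (frob_norm (A *m (0 : 'cV[R]_n))), 0 => //=; rewrite frob_norm0.
exists (Num.sqrt (\sum_i (\sum_j `|A i j|) ^+ 2)) => _ [x /= x1 <-].
rewrite ler_sqrt; last by rewrite sumr_ge0// => i _; rewrite sqr_ge0.
apply: ler_sum => i _; rewrite big_ord1 -[leLHS]real_normK ?num_real//.
rewrite ler_sqr ?nnegrE// ?sumr_ge0// mxE.
apply: le_trans (ler_norm_sum _ _ _) _; apply: ler_sum => j _.
rewrite normrM ler_piMr// -(@ler_sqr _ `|_| 1) ?nnegrE// real_normK ?num_real// expr1n.
apply: le_trans (_ : frob_norm x ^+ 2 <= 1); last by rewrite expr_le1// frob_norm_ge0.
rewrite frob_norm_cV (bigD1 j)//= lerDl sumr_ge0// => k _; exact: sqr_ge0.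
Qed.

Lemma frob_norm_mulmx_le m n (A : 'M[R]_(m, n)) (x : 'cV[R]_n) :
  frob_norm (A *m x) <= op_norm A * frob_norm x.
Proof.
have [x0|x0] := eqVneq (frob_norm x) 0.
  suff -> : x = 0.
    by rewrite mulmx0 !frob_norm0 mulr0.
  apply/colP => i; rewrite mxE; apply/eqP; rewrite -sqrf_eq0.
  have : frob_norm x ^+ 2 == 0 by rewrite x0 expr0n.
  rewrite frob_norm_cV psumr_eq0; last by move=> ? _; exact: sqr_ge0.
  by move/allP/(_ i); rewrite mem_index_enum; apply.
have x_gt0 : 0 < frob_norm x by rewrite lt_def x0 frob_norm_ge0.
rewrite -ler_pdivrMr// mulrC -frob_normZ ?invr_ge0 ?frob_norm_ge0// scalemxAr.
apply: (sup_upper_bound (op_norm_has_sup A)).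
by exists ((frob_norm x)^-1 *: x) => //=; rewrite frob_normZ ?invr_ge0 ?frob_norm_ge0// mulVf.
Qed.

Lemma op_norm_ge0 m n (A : 'M[R]_(m, n)) : 0 <= op_norm A.
Proof.
apply: le_trans (_ : frob_norm (A *m (0 : 'cV[R]_n)) <= _); first exact: frob_norm_ge0.
apply: (sup_upper_bound (op_norm_has_sup A)); exists 0 => //=.
by rewrite frob_norm0.
Qed.

(** Jensen by the tangent line of the exponential at the mean [a]: the linear terms sum to zero. *)
Lemma expR_avg_le (I : finType) (x : I -> R) : (0 < #|I|)%N ->
  expR ((\sum_i x i) / #|I|%:R) <= (\sum_i expR (x i)) / #|I|%:R.
Proof.
move=> I0; have n0 : (0 : R) < #|I|%:R by rewrite ltr0n.
set a := _ / _; rewrite ler_pdivlMr//.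
have h : \sum_i expR a * (1 + (x i - a)) = expR a * #|I|%:R.
  rewrite -mulr_sumr big_split/= sumr_const sumrB sumr_const -(mulr_natr a).
  by rewrite /a divfK ?gt_eqF// subrr addr0.
rewrite -h; apply: ler_sum => i _.
by rewrite -{2}(subrK a (x i)) [_ + a]addrC expRD ler_pM2l ?expR_gt0// expR_ge1Dx.
Qed.

Lemma sum_inj_le (I J : finType) (p : I -> J) (h : J -> R) :
  injective p -> (forall j, 0 <= h j) -> \sum_i h (p i) <= \sum_j h j.
Proof.
move=> pI h0; rewrite [leRHS](bigID (mem [set p i | i in [set: I]]%SET))/=.
rewrite big_imset/=; last by move=> ? ? _ _; apply: pI.
have -> : \sum_i h (p i) = \sum_(i in [set: I]%SET) h (p i).
  by apply: eq_bigl => i; rewrite inE.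
by rewrite lerDl sumr_ge0.
Qed.

End Norms.

(** * Row sums over [B] and the pair sums built from them *)

Section PairSums.
Variables (R : realType) (N : nat) (A C : 'M[R]_N).
Implicit Types (s : 'S_N) (B : {set 'I_N}) (i j l : 'I_N).

(** The value [l] is kept apart from [s i]: for fixed [l] the sum depends on [s] only through its
    values on [B], so resampling outside [B] leaves it alone. *)
Definition part_row B s i l := \sum_(j in B) C i j * A l (s j).

Definition row_gap B i i' s l := part_row B s i l - part_row B s i' l.

(** This is D_k, arranged as a difference of two terms that each involve a single value of [s]
    outside [B]. *)
Definition swap_gap B i i' s := row_gap B i i' s (s i) - row_gap B i i' s (s i').

Definition pair_sum (K : finType) (p : bool -> K -> 'I_N) B s :=
  \sum_k swap_gap B (p true k) (p false k) s.

Lemma part_row_tperm B s i l a b : a \notin B -> b \notin B ->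
  part_row B (tperm a b * s)%g i l = part_row B s i l.
Proof.
move=> aB bB; apply: eq_bigr => j jB; rewrite permM tpermD//.
  by apply: contraNneq aB => ->.
by apply: contraNneq bB => ->.
Qed.

Lemma swap_gap_swap B i i' s : i \notin B -> i' \notin B ->
  swap_gap B i i' (tperm i i' * s)%g = - swap_gap B i i' s.
Proof.
move=> iB iB'; rewrite /swap_gap /row_gap !part_row_tperm// !permM tpermL tpermR.
by rewrite [RHS]opprB.
Qed.

Lemma swap_gap_tperm B i i' s a b : a \notin B -> b \notin B ->
    i != a -> i != b -> i' != a -> i' != b ->
  swap_gap B i i' (tperm a b * s)%g = swap_gap B i i' s.
Proof.
move=> aB bB ia ib ia' ib'; rewrite /swap_gap /row_gap !part_row_tperm// !permM.
by rewrite !tpermD// eq_sym.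
Qed.

(** For fixed [l], the column of all [part_row B s i l] is [C] times row [l] of [A], permuted by [s]
    and cut off outside [B]. *)
Lemma sum_part_row_sqr_le B s :
  \sum_i \sum_l part_row B s i l ^+ 2 <= op_norm C ^+ 2 * frob_norm A ^+ 2.
Proof.
pose y l := (\col_j (if j \in B then A l (s j) else 0) : 'cV[R]_N).
rewrite exchange_big/= frob_norm_sqr mulr_sumr; apply: ler_sum => l _.
have -> : \sum_i part_row B s i l ^+ 2 = frob_norm (C *m y l) ^+ 2.
  rewrite frob_norm_cV; apply: eq_bigr => i _; congr (_ ^+ 2).
  rewrite mxE /part_row big_mkcond/=; apply: eq_bigr => j _.
  by rewrite mxE; case: ifP => // _; rewrite mulr0.
apply: le_trans (_ : op_norm C ^+ 2 * frob_norm (y l) ^+ 2 <= _).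
  rewrite -exprMn ler_sqr ?nnegrE ?mulr_ge0 ?frob_norm_ge0 ?op_norm_ge0//.
  exact: frob_norm_mulmx_le.
rewrite ler_wpM2l ?sqr_ge0// frob_norm_cV.
rewrite [leRHS](reindex_inj (@perm_inj _ s))/=; apply: ler_sum => j _.
by rewrite mxE; case: ifP => // _; rewrite expr0n sqr_ge0.
Qed.

(** * Moments of the pair sum for fixed disjoint pairs outside [B] *)

Section FixedPairs.
Variables (K : finType) (p : bool -> K -> 'I_N) (B : {set 'I_N}).
Hypothesis p_inj : injective (fun x : bool * K => p x.1 x.2).
Hypothesis pB : forall b k, p b k \notin B.

Let pD b b' k k' : k != k' -> p b k != p b' k'.
Proof. by apply: contraNneq => e; have [_ ->] := @p_inj (b, k) (b', k') e. Qed.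

Lemma sum_pair_sum : \sum_s pair_sum p B s = 0.
Proof.
rewrite exchange_big big1// => k _; set S := (X in X = 0).
have : S = - S.
  rewrite {1}/S (sum_perm_mull (tperm (p true k) (p false k))) -sumrN.
  by apply: eq_bigr => s _; rewrite swap_gap_swap.
by lra.
Qed.

(** The factor 4 is 2 for counting each gap at both positions of its pair, times 2 from (a - b)^2 <=
    2 a^2 + 2 b^2. Injectivity of [p] keeps the rows distinct. *)
Lemma sum_gap_sqr_le s :
  \sum_(x : bool * K) \sum_(j in ~: B) row_gap B (p true x.2) (p false x.2) s (s j) ^+ 2
  <= 4 * (op_norm C ^+ 2 * frob_norm A ^+ 2).
Proof.
set u := fun k l => row_gap B (p true k) (p false k) s l.
apply: le_trans (_ : \sum_(x : bool * K) \sum_l u x.2 l ^+ 2 <= _).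
  apply: ler_sum => x _; rewrite [leRHS](reindex_inj (@perm_inj _ s))/=.
  by rewrite [leRHS](bigID (mem (~: B)))/= lerDl sumr_ge0// => j _; exact: sqr_ge0.
pose w i := \sum_l part_row B s i l ^+ 2.
have w0 i : 0 <= w i by rewrite sumr_ge0// => l _; exact: sqr_ge0.
apply: le_trans (_ : 4 * \sum_(x : bool * K) w (p x.1 x.2) <= _); last first.
  rewrite ler_pM2l//; apply: le_trans (sum_part_row_sqr_le B s).
  exact: (@sum_inj_le _ _ _ (fun x : bool * K => p x.1 x.2) w).
rewrite -[leLHS](pair_bigA _ (fun b k => \sum_l u k l ^+ 2))/=.
rewrite -(pair_bigA _ (fun b k => w (p b k)))/= !big_bool/= -!big_split mulr_sumr/=.
apply: ler_sum => k _; rewrite -!big_split mulr_sumr/=; apply: ler_sum => l _.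
rewrite /u /row_gap; set a := part_row _ _ _ _; set b := part_row _ _ _ _.
by have := sqr_ge0 (a + b); lra.
Qed.

Lemma pair_sum_mgf (m : nat) (nu theta : R) : (0 < m)%N ->
    (2 * #|K| + m <= #|~: B| + 1)%N ->
    (forall s i l, `|part_row B s i l| <= nu) -> 0 <= theta ->
  \sum_s expR (theta * pair_sum p B s) <= N`!%:R *
    expR (8 * theta ^+ 2 * (op_norm C ^+ 2 * frob_norm A ^+ 2) / m%:R
          * expR (4 * theta * nu)).
Proof.
move=> m0 cK rnu th0; set V := op_norm C ^+ 2 * _.
pose D k s := theta * swap_gap B (p true k) (p false k) s.
pose u k s l := row_gap B (p true k) (p false k) s l.
pose f (x : bool * K) s l := cosh (2 * (theta * u x.2 s l)) - 1.
have f0 x s l : 0 <= f x s l by rewrite subr_ge0 cosh_ge1.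
have fE x s l : 1 + f x s l = cosh (2 * (theta * u x.2 s l)) by rewrite addrC subrK.
have u_tperm k s l a b : a \notin B -> b \notin B -> u k (tperm a b * s)%g l = u k s l.
  by move=> aB bB; rewrite /u /row_gap !part_row_tperm.
have -> : \sum_s expR (theta * pair_sum p B s) =
    \sum_s 1 * \prod_(k <- enum K) cosh (D k s).
  rewrite -(@symmetrize _ _ _ (fun k => tperm (p true k) (p false k)) D); first last.
  - exact: enum_uniq.
  - by [].
  - by move=> k k' s kk'; rewrite /D swap_gap_tperm ?pD.
  - by move=> k s; rewrite /D swap_gap_swap// mulrN.
  apply: eq_bigr => s _; rewrite mul1r /pair_sum mulr_sumr expR_sum.
  by rewrite big_enum.
pose ks := enum {: bool * K}.
pose pos (x : bool * K) := p x.1 x.2.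
(* Each pair factor splits by [cosh_sub_le] into one factor per position, in the form 1 +
   (nonnegative) that [expose] takes. *)
apply: le_trans (_ : \sum_s 1 * \prod_(x <- ks) (1 + f x s (s (pos x))) <= _).
  apply: ler_sum => s _; rewrite !mul1r !big_enum/=.
  rewrite -(pair_bigA _ (fun b k => 1 + f (b, k) s (s (p b k))))/= big_bool/= -big_split/=.
  apply: ler_prod => k _; rewrite (ltW (cosh_gt0 _))/= !fE.
  rewrite /D /swap_gap mulrBr; exact: cosh_sub_le.
apply: le_trans (expose (A := ~: B) m0 f0 _ _ _ _ _ _) _ => //.
- by move=> x s l i j; rewrite !inE => iB jB; rewrite /f u_tperm.
- by rewrite map_inj_uniq ?enum_uniq.
- by apply/allP => _ /mapP[x _ ->]; rewrite /= inE pB.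
- by rewrite -cardT card_prod card_bool.
rewrite -card_Sn mulr_natl -sumr_const; apply: ler_sum => s _.
rewrite mul1r.
apply: le_trans (_ : \prod_(x <- ks) expR (m%:R^-1 * \sum_(j in ~: B) f x s (s j)) <= _).
  apply: ler_prod => x _; rewrite expR_ge1Dx andbT addr_ge0// mulr_ge0 ?invr_ge0//.
  by rewrite sumr_ge0.
rewrite -expR_sum ler_expR -mulr_sumr big_enum/=.
have m0R : (0 : R) < m%:R by rewrite ltr0n.
rewrite [_ / m%:R]mulrC -[leRHS]mulrA ler_pM2l ?invr_gt0//.
set E := expR _.
apply: le_trans (_ : \sum_(x : bool * K) \sum_(j in ~: B)
    2 * theta ^+ 2 * E * u x.2 s (s j) ^+ 2 <= _).
  apply: ler_sum => x _; apply: ler_sum => j _; rewrite /f.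
  (* A gap is a difference of two row sums, hence at most [2 * nu], and the argument of [cosh] is
     [2 * theta] times it. *)
  apply: le_trans (cosh_sub1_le (z := 4 * theta * nu) _) _.
    rewrite 2!normrM (ger0_norm th0) ger0_norm//.
    have : `|u x.2 s (s j)| <= nu + nu by apply: le_trans (ler_normB _ _) _; rewrite lerD.
    by nra.
  rewrite -/E; set v := u _ _ _.
  suff -> : (2 * (theta * v)) ^+ 2 / 2 * E = 2 * theta ^+ 2 * E * v ^+ 2 by [].
  by field.
under eq_bigr do rewrite -mulr_sumr.
rewrite -mulr_sumr; have := sum_gap_sqr_le s; rewrite -/V => h.
have c0 : 0 <= 2 * theta ^+ 2 * E by rewrite !mulr_ge0// ?sqr_ge0// expR_ge0.
apply: le_trans (ler_wpM2l c0 h) _.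
suff -> : 2 * theta ^+ 2 * E * (4 * V) = 8 * theta ^+ 2 * V * E by [].
by ring.
Qed.

End FixedPairs.

End PairSums.

(** * The form as an average of pair sums over relabellings *)

Section Averaging.
Variables (R : realType) (N : nat) (A C : 'M[R]_N).
Hypothesis C0 : forall i, C i i = 0.
Hypothesis Ccol : forall j, \sum_i C i j = 0.

(** The images of [i], [i'], [j] form a uniform triple of distinct indices; resampling them in turn
    gives the factors [N - 2], [N - 1] and [N], and [N - 1] finally cancels. *)
Lemma sum_triple (b : 'I_N -> 'I_N -> R) i i' j : i != i' -> i != j -> i' != j ->
  N%:R * (N - 2)%:R *
    \sum_(r : 'S_N) (C (r i) (r j) - C (r i') (r j)) * (b (r i) (r j) - b (r i') (r j)) =
  2 * N`!%:R * \sum_x \sum_z C x z * b x z.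
Proof.
move=> ii' ij i'j; set S := \sum_(r : 'S_N) _.
have N1 : (1 < N)%N.
  rewrite -[N]card_ord -cardsT; apply: leq_trans (subset_leq_card (finset.subsetT [set i; j])).
  by rewrite cards2 ij.
pose f x y z := (C x z - C y z) * (b x z - b y z).
pose f2 y z := \sum_(x in ~: [set z]) f x y z.
pose f1 z := \sum_(y in ~: [set z]) f2 y z.
have img (r : 'S_N) (z : 'I_N) (h : 'I_N -> R) :
    \sum_(x in ~: [set z]) h (r x) = \sum_(x in ~: [set r z]) h x.
  rewrite [RHS](reindex_inj (@perm_inj _ r))/=; apply: eq_bigl => x.
  by rewrite !inE (inj_eq perm_inj).
have e2 : (N - 2)%:R * S = \sum_(r : 'S_N) f2 (r i') (r j).
  rewrite (_ : S = \sum_(r : 'S_N) f (r i) (r i') (r j))//.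
  have -> : (N - 2)%N = #|~: [set i'; j]| by rewrite cardsCs finset.setCK card_ord cards2 i'j.
  rewrite (@resample _ _ _ i (fun (r : 'S_N) l => f l (r i') (r j))); last first.
    move=> k r l; rewrite !inE negb_or => /andP[ki' kj].
    by rewrite !permM !tpermD// eq_sym.
  apply: eq_bigr => r _; rewrite /f2 -img [RHS](bigD1 i')/=; last by rewrite !inE.
  (* The term of [f2] where both row indices coincide vanishes, so [f2] may include it. *)
  rewrite [X in _ = X + _]/f subrr mul0r add0r; apply: eq_bigl => x; rewrite !inE negb_or.
  by rewrite andbC.
have e1 : (N - 1)%:R * \sum_(r : 'S_N) f2 (r i') (r j) = \sum_(r : 'S_N) f1 (r j).
  have -> : (N - 1)%N = #|~: [set j]| by rewrite cardsC1 card_ord subn1.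
  rewrite (@resample _ _ _ i' (fun (r : 'S_N) l => f2 l (r j))); last first.
    by move=> k r l; rewrite !inE => kj; rewrite !permM !tpermD// eq_sym.
  by apply: eq_bigr => r _; rewrite /f1 -img.
have e0 : N%:R * \sum_(r : 'S_N) f1 (r j) = N`!%:R * \sum_z f1 z.
  rewrite -{1}[N]card_ord -cardsT (@resample _ _ _ j (fun (r : 'S_N) l => f1 l))//.
  rewrite mulr_natl -card_Sn -sumr_const; apply: eq_bigr => r _.
  rewrite [RHS](reindex_inj (@perm_inj _ r))/=.
  by apply: eq_bigl => z; rewrite inE.
(* Expanding the product, the cross terms vanish because column [z] of [C] sums to zero off the
   diagonal. *)
have f1E z : f1 z = 2 * (N - 1)%:R * \sum_x C x z * b x z.
  have Cz (h : 'I_N -> R) :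
      \sum_(x in ~: [set z]) C x z * h x = \sum_x C x z * h x.
    rewrite [RHS](bigD1 z)//= C0 mul0r add0r; apply: eq_bigl => x; by rewrite !inE.
  have cz : \sum_(x in ~: [set z]) C x z = 0.
    have := Cz (fun=> 1); under eq_bigr do rewrite mulr1.
    by under [in RHS]eq_bigr do rewrite mulr1; rewrite Ccol.
  have cN : #|~: [set z]| = (N - 1)%N by rewrite cardsC1 card_ord subn1.
  set Sz := \sum_x _; set bz := \sum_(x in ~: [set z]) b x z.
  have f2E y : f2 y z = Sz - C y z * bz + (N - 1)%:R * (C y z * b y z).
    transitivity (\sum_(x in ~: [set z]) (C x z * b x z - C x z * b y z
        - C y z * b x z + C y z * b y z)).
      by apply: eq_bigr => x _; rewrite /f; ring.
    rewrite big_split/= !sumrB Cz -mulr_suml cz mul0r subr0 -mulr_sumr.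
    by rewrite sumr_const cN mulr_natl.
  rewrite /f1 (eq_bigr _ (fun y _ => f2E y)) big_split/= sumrB sumr_const cN.
  by rewrite -mulr_suml cz -mulr_sumr Cz -/Sz -mulr_natl; ring.
have n1 : (N - 1)%:R != 0 :> R by rewrite pnatr_eq0 -lt0n subn_gt0.
apply: (mulfI n1).
transitivity (N%:R * ((N - 1)%:R * ((N - 2)%:R * S))); first by ring.
rewrite e2 e1 e0 (eq_bigr _ (fun z _ => f1E z)) -mulr_sumr exchange_big/=; ring.
Qed.

Variables (K : finType) (p : bool -> K -> 'I_N) (B : {set 'I_N}).
Hypothesis p_inj : injective (fun x : bool * K => p x.1 x.2).
Hypothesis pB : forall b k, p b k \notin B.

(** By [sum_triple], every choice of a pair [k] and a [j] in [B] contributes the same amount. *)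
Lemma avg_pair_sum s :
  N%:R * (N - 2)%:R * \sum_(r : 'S_N) pair_sum A C (fun b k => r (p b k)) (r @: B) s =
  2 * (#|K| * #|B|)%:R * (N`!%:R * perm_form A C s).
Proof.
pose b x z := A (s x) (s z).
have -> : \sum_(r : 'S_N) pair_sum A C (fun b k => r (p b k)) (r @: B) s =
    \sum_k \sum_(j in B) \sum_(r : 'S_N)
      (C (r (p true k)) (r j) - C (r (p false k)) (r j)) *
      (b (r (p true k)) (r j) - b (r (p false k)) (r j)).
  under [RHS]eq_bigr do rewrite exchange_big.
  rewrite [RHS]exchange_big/=; apply: eq_bigr => r _; apply: eq_bigr => k _.
  rewrite /swap_gap /row_gap /part_row !(big_imset _ (in2W (@perm_inj _ r)))/=.
  rewrite -!sumrB; apply: eq_bigr => j _; rewrite /b; ring.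
rewrite mulr_sumr (eq_bigr (fun=> #|B|%:R * (2 * N`!%:R * perm_form A C s))).
  by rewrite sumr_const -mulr_natl natrM; ring.
move=> k _; rewrite mulr_sumr [RHS]mulr_natl -sumr_const; apply: eq_bigr => j jB.
have ne c : p c k != j by apply: contraNneq (pB c k) => ->.
rewrite sum_triple//.
by apply/eqP => e; have := @p_inj (true, k) (false, k) e.
Qed.

Lemma form_eq_avg s : (0 < #|K|)%N -> (0 < #|B|)%N ->
  perm_form A C s = N%:R * (N - 2)%:R / (2 * #|K|%:R * #|B|%:R) *
    ((\sum_(r : 'S_N) pair_sum A C (fun b k => r (p b k)) (r @: B) s) / N`!%:R).
Proof.
move=> K0 B0; have := avg_pair_sum s; rewrite natrM; set S := \sum_(r : 'S_N) _ => e.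
have n0 : N`!%:R != 0 :> R by rewrite pnatr_eq0 -lt0n fact_gt0.
have k0 : #|K|%:R != 0 :> R by rewrite pnatr_eq0 -lt0n.
have b0 : #|B|%:R != 0 :> R by rewrite pnatr_eq0 -lt0n.
rewrite mulrACA e -invfM; field.
by rewrite n0 k0 b0.
Qed.

Lemma sum_perm_form : (0 < #|K|)%N -> (0 < #|B|)%N -> \sum_s perm_form A C s = 0.
Proof.
move=> K0 B0; rewrite (eq_bigr _ (fun s _ => form_eq_avg s K0 B0)) -mulr_sumr.
rewrite -mulr_suml exchange_big/= big1 ?mul0r ?mulr0// => r _.
apply: sum_pair_sum => c k.
by rewrite mem_imset//; exact: perm_inj.
Qed.

Lemma perm_form_mgf (m : nat) (nu kappa lambda : R) :
    (0 < #|K|)%N -> (0 < #|B|)%N -> (0 < m)%N ->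
    (2 * #|K| + m <= #|~: B| + 1)%N ->
    (forall (r s : 'S_N) i l, `|part_row A C (r @: B) s i l| <= nu) ->
    N%:R * (N - 2)%:R / (2 * #|K|%:R * #|B|%:R) <= kappa ->
    0 <= lambda ->
  (\sum_s expR (lambda * perm_form A C s)) / N`!%:R <=
    expR (8 * (lambda * kappa) ^+ 2 * (op_norm C ^+ 2 * frob_norm A ^+ 2) / m%:R
          * expR (4 * (lambda * kappa) * nu)).
Proof.
move=> K0 B0 m0 cK rnu kk l0; set k0 := (_ / _) in kk.
have k0_ge0 : 0 <= k0 by rewrite divr_ge0 ?mulr_ge0.
have n_gt0 : (0 : R) < N`!%:R by rewrite ltr0n fact_gt0.
set V := op_norm C ^+ 2 * _.
pose bnd k := expR (8 * (lambda * k) ^+ 2 * V / m%:R * expR (4 * (lambda * k) * nu)).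
have nu0 : 0 <= nu.
  have [//|] := leP 0 nu; have /card_gt0P[j _] := B0 => nu0.
  by have := le_lt_trans (rnu 1%g 1%g j j) nu0; rewrite normr_lt0.
have V0 : 0 <= V by rewrite mulr_ge0 ?sqr_ge0.
(* The bound increases with [kappa], so the exact ratio [k0] may be used. *)
apply: le_trans (_ : bnd k0 <= _); last first.
  rewrite /bnd ler_expR ler_pM ?expR_ge0//.
    by rewrite divr_ge0// mulr_ge0// mulr_ge0 ?sqr_ge0.
    rewrite ler_wpM2r ?invr_ge0// ler_wpM2r// ler_wpM2l//.
    by rewrite lerXn2r ?nnegrE ?mulr_ge0 ?ler_wpM2l// (le_trans k0_ge0).
  by rewrite ler_expR ler_wpM2r// ler_wpM2l// ler_wpM2l.
rewrite ler_pdivrMr//.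
pose X r s := lambda * k0 * pair_sum A C (fun b k => r (p b k)) (r @: B) s.
apply: le_trans (_ : \sum_s (\sum_(r : 'S_N) expR (X r s)) / N`!%:R <= _).
  apply: ler_sum => s _; rewrite (form_eq_avg s K0 B0) -/k0.
  have := @expR_avg_le _ 'S_N (fun r => X r s); rewrite card_Sn fact_gt0 => /(_ isT).
  by rewrite -mulr_sumr !mulrA.
rewrite -mulr_suml ler_pdivrMr// exchange_big/= -mulrA [leRHS]mulrC -mulrA.
rewrite mulr_natl -card_Sn -sumr_const; apply: ler_sum => r _.
rewrite card_Sn; apply: pair_sum_mgf => //.
- by move=> x y /perm_inj/p_inj.
- by move=> b k; rewrite mem_imset//; exact: perm_inj.
- have -> : #|~: (r @: B)| = #|~: B|.
    by rewrite [LHS]cardsCs [RHS]cardsCs !finset.setCK (card_imset _ (@perm_inj _ r)).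
  exact: cK.
- by rewrite mulr_ge0.
Qed.

End Averaging.

(** * Probabilities and expectations under a uniform permutation *)

Section UniformPermutation.
Variables (R : realType) (d : measure_display) (T : measurableType d).
Variables (P : probability T R) (N : nat) (pi : T -> 'S_N).
Hypothesis piU : uniform_perm P pi.

(** The hypothesis speaks of single permutations; other events are finite disjoint unions of their
    fibres. *)
Lemma uniform_perm_seq (ss : seq 'S_N) : uniq ss ->
  measurable [set w | pi w \in ss] /\
  P [set w | pi w \in ss] = ((size ss)%:R / N`!%:R)%:E.
Proof.
elim: ss => [_|s ss IH /= /andP[sss /IH[mss Pss]]].
  have -> : [set w | pi w \in [::]] = set0 by apply/seteqP; split.
  by rewrite measure0 mul0r.
have [ms Ps] := piU s.
have -> : [set w | pi w \in s :: ss] = pi @^-1` [set s] `|` [set w | pi w \in ss].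
  apply/seteqP; split => w /=; rewrite inE.
    by case/orP => [/eqP|]; [left|right].
  by case=> [->|->]; rewrite ?eqxx ?orbT.
split; first exact: measurableU.
transitivity (P (pi @^-1` [set s]) + P [set w | pi w \in ss])%E.
  apply: measureU => //.
  by apply/seteqP; split => w //= -[->]; rewrite (negbTE sss).
by rewrite Ps Pss -EFinD -addn1 natrD mulrDl mul1r addrC.
Qed.

Lemma uniform_perm_expectation (Q : 'S_N -> R) :
  ('E_P[Q \o pi] = ((\sum_s Q s) / N`!%:R)%:E)%E.
Proof.
have mpi (q : pred 'S_N) : measurable [set w | q (pi w)].
  rewrite (_ : mkset _ = [set w | pi w \in enum q]).
    by have [] := uniform_perm_seq (enum_uniq q).
  by apply/seteqP; split => w /=; rewrite mem_enum.
have mQ : measurable_fun setT (Q \o pi).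
  move=> _ Y mY; rewrite setTI (_ : _ @^-1` _ = [set w | `[< Y (Q (pi w)) >]]).
    exact: (mpi (fun s => `[< Y (Q s) >])).
  by apply/seteqP; split => w /=; rewrite asboolE.
have UT : \big[setU/set0]_(s <- enum 'S_N) (pi @^-1` [set s]) = setT.
  apply/seteqP; split => // w _; rewrite -bigcup_seq; exists (pi w) => //=.
  by rewrite mem_enum.
rewrite unlock -UT integral_bigsetU_EFin ?enum_uniq//.
- rewrite big_enum/= mulr_suml -sumEFin; apply: eq_bigr => s _.
  have [ms Ps] := piU s.
  rewrite (eq_integral (cst (Q s)%:E)); last first.
    by move=> w; rewrite inE/= => ->.
  by rewrite integral_cst// EFinM -Ps.
- by move=> s; have [] := piU s.
- by apply/trivIsetP => s s' _ _ ss'; apply/seteqP; split => w //= [->] /eqP; rewrite (negbTE ss').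
- by rewrite UT; exact/measurable_EFinP.
Qed.

End UniformPermutation.

(** * Choice of pairs and the moment bound in terms of [half_max] *)

Definition first_half N : {set 'I_N} := [set k : 'I_N | (k < N./2)%N]%SET.

Lemma card_first_half N : #|first_half N| = N./2.
Proof.
have h : (N./2 <= N)%N by lia.
rewrite -sum1_card (eq_bigl (fun k : 'I_N => (k < N./2)%N)); last by move=> k; rewrite inE.
by rewrite -(big_ord_widen N (fun=> 1%N) h) sum1_card card_ord.
Qed.

Section Bennett.
Variables (R : realType) (N : nat) (A C : 'M[R]_N).

Lemma half_max_ge i j (s s' : 'S_N) :
  `| \sum_(k < N | (k < N./2)%N) C i (s k) * A j (s' k) | <= half_max A C.
Proof.
apply: le_trans (le_bigmax _ _ i); apply: le_trans (le_bigmax _ _ j).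
by apply: le_trans (le_bigmax _ _ s); apply: le_trans (le_bigmax _ _ s').
Qed.

Lemma half_max_ge0 : 0 <= half_max A C.
Proof. exact: bigmax_ge_id. Qed.

(** The two permutations in the maximum are taken to be [r] and [r * s]. *)
Lemma part_row_le (r s : 'S_N) i l :
  `|part_row A C (r @: first_half N) s i l| <= half_max A C.
Proof.
rewrite /part_row (big_imset _ (in2W (@perm_inj _ r)))/=.
rewrite (_ : \sum_(_ in _) _ = \sum_(k < N | (k < N./2)%N) C i (r k) * A l ((r * s)%g k)).
  exact: half_max_ge.
by apply: eq_big => [k|k _]; [rewrite inE|rewrite permM].
Qed.

Lemma pairs_exist : (2 < N)%N -> exists (P : nat) (p : bool -> 'I_P -> 'I_N),
  [/\ injective (fun x : bool * 'I_P => p x.1 x.2),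
      forall b k, p b k \notin first_half N,
      (2 * P <= N - N./2)%N, (N <= 8 * P)%N & (N <= 8 * (N - N./2 - 2 * P + 1))%N].
Proof.
(* A quarter of the second half, rounded up: the pairs use about half of these positions and leave
   the rest spare. The pairs are consecutive positions from [N./2] on. *)
move=> N2; pose P := ((N - N./2 + 3) %/ 4)%N.
have lt (b : bool) (k : 'I_P) : (N./2 + 2 * k + b < N)%N.
  by have := ltn_ord k; rewrite /P; case: b; lia.
exists P, (fun b k => Ordinal (lt b k)); split.
- move=> [b k] [b' k'] /= [] e.
  have [bb kk] : b = b' /\ k = k' :> nat by case: b b' e => -[]; lia.
  by rewrite bb; congr pair; apply: val_inj.
- by move=> b k; rewrite inE /=; lia.
- by rewrite /P; lia.
- by rewrite /P; lia.
- by rewrite /P; lia.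
Qed.

Hypothesis C0 : forall i, C i i = 0.
Hypothesis Ccol : forall j, \sum_i C i j = 0.
Hypothesis N2 : (2 < N)%N.

Let nu := half_max A C.
Let V := op_norm C ^+ 2 * frob_norm A ^+ 2.

Let half_gt0 : (0 < N./2)%N. Proof. by lia. Qed.

Lemma sum_perm_form0 : \sum_s perm_form A C s = 0.
Proof.
have [P [p [pI pB _ NP _]]] := pairs_exist N2.
have P0 : (0 < P)%N by lia.
by apply: (sum_perm_form A C0 Ccol pI pB); rewrite ?card_ord ?card_first_half.
Qed.

Lemma perm_form_eq0 : nu = 0 -> forall s, perm_form A C s = 0.
Proof.
move=> nu0 s; have [P [p [pI pB _ NP _]]] := pairs_exist N2.
have P0 : (0 < P)%N by lia.
rewrite (form_eq_avg A C0 Ccol pI pB) ?card_ord ?card_first_half// big1 ?mul0r ?mulr0// => r _.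
have z i l : part_row A C (r @: first_half N) s i l = 0.
  by apply/eqP; rewrite -normr_le0 -nu0 part_row_le.
by rewrite /pair_sum big1// => k _; rewrite /swap_gap /row_gap !z !subr0.
Qed.

Lemma perm_form_mgf_half_max (lambda : R) : 0 <= lambda ->
  (\sum_s expR (lambda * perm_form A C s)) / N`!%:R <=
    expR (4096 * lambda ^+ 2 * V / N%:R * expR (32 * lambda * nu)).
Proof.
move=> l0; have [P [p [pI pB P2 NP Nm]]] := pairs_exist N2.
have P0 : (0 < P)%N by lia.
set m := (_ - _ + 1)%N in Nm.
have m0 : (0 < m)%N by rewrite /m addn1.
have N_gt0 : (0 : R) < N%:R by rewrite ltr0n; lia.
(* [kappa] is 8 since [N <= 8 * P] and [N - 2 <= 2 * N./2]. With 1/m <= 8/N this yields 4096 = 8 *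
   8^2 * 8 and 32 = 4 * 8. *)
apply: le_trans (@perm_form_mgf _ _ A C C0 Ccol _ p _ pI pB m nu 8 lambda _ _ _ _ _ _ _) _.
- by rewrite card_ord.
- by rewrite card_first_half.
- exact: m0.
- by rewrite cardsCs finset.setCK card_ord card_first_half card_ord /m; lia.
- by move=> r s i l; exact: part_row_le.
- rewrite !card_ord card_first_half ler_pdivrMr ?mulr_gt0 ?ltr0n//.
  rewrite -!natrM ler_nat.
  have : (N - 2 <= 2 * N./2)%N by lia.
  by move=> h; rewrite (leq_trans (leq_mul NP h))//; lia.
- by [].
rewrite ler_expR; have -> : 4 * (lambda * 8) * nu = 32 * lambda * nu by ring.
rewrite ler_wpM2r ?expR_ge0//.
have -> : 4096 * lambda ^+ 2 * V / N%:R = 8 * (lambda * 8) ^+ 2 * V * (8 / N%:R) by field; rewrite gt_eqF.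
have V0 : 0 <= V by rewrite mulr_ge0 ?sqr_ge0.
apply: ler_wpM2l; first by rewrite mulr_ge0// mulr_ge0// sqr_ge0.
rewrite ler_pdivlMr// mulrC ler_pdivrMr ?ltr0n//.
by rewrite -natrM ler_nat.
Qed.

End Bennett.

(** * Choice of the Chernoff parameter *)

Lemma bennett_exponent (R : realType) (nu V n t : R) :
    0 < nu -> 0 < V -> 0 < n -> 0 <= t ->
  exists2 lambda, 0 <= lambda &
    4096 * lambda ^+ 2 * V / n * expR (32 * lambda * nu) - lambda * t <=
    - (t / (256 * nu) * ln (1 + n * nu * t / (256 * V))).
Proof.
move=> nu0 V0 n0 t0; have [nu0' V0' n0'] := And3 (ltW nu0) (ltW V0) (ltW n0).
have [y y0 ->] : exists2 y, 0 <= y & t = 256 * V * y / (n * nu).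
  exists (n * nu * t / (256 * V)).
    by apply: divr_ge0; [rewrite !mulr_ge0|exact: mulr_ge0 (ler0n _ _) V0'].
  by field; rewrite !gt_eqF.
have -> : n * nu * (256 * V * y / (n * nu)) / (256 * V) = y by field; rewrite !gt_eqF.
have : 0 <= ln (1 + y) by rewrite ln_ge0// lerDl.
have : expR (ln (1 + y)) = 1 + y by rewrite lnK// posrE ltr_pwDl.
move: (ln (1 + y)) => L LE L0.
(* Makes the inner exponential [expR (L / 2)], the square root of [1 + y], so [mul_expR_le] bounds
   its product with [L / 2] by [y]. *)
exists (L / (64 * nu)); first by rewrite divr_ge0// mulr_ge0.
have -> : 32 * (L / (64 * nu)) * nu = L / 2 by field; rewrite gt_eqF.
have : (L / 2) * expR (L / 2) <= y.
  apply: le_trans (mul_expR_le _) _; first by rewrite divr_ge0.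
  by rewrite mulrCA divff// mulr1 LE addrAC subrr add0r.
move: (expR _) => E key.
have -> : 4096 * (L / (64 * nu)) ^+ 2 * V / n * E = 2 * (L * V / (n * nu ^+ 2)) * (L / 2 * E).
  by field; rewrite !gt_eqF.
have c0 : 0 <= L * V / (n * nu ^+ 2).
  by apply: divr_ge0; [exact: mulr_ge0|exact: mulr_ge0 (sqr_ge0 _)].
rewrite -subr_ge0.
have -> : - (256 * V * y / (n * nu) / (256 * nu) * L) -
    (2 * (L * V / (n * nu ^+ 2)) * (L / 2 * E) - L / (64 * nu) * (256 * V * y / (n * nu))) =
    L * V / (n * nu ^+ 2) * (y + 2 * (y - L / 2 * E)).
  by field; rewrite !gt_eqF.
by rewrite mulr_ge0// addr_ge0// mulr_ge0// subr_ge0.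
Qed.

(** * Degenerate cases and the tail bound *)

Lemma bennett_bound0 (R : realType) (K : R) N nu V : bennett_bound K N nu V 0 = 1.
Proof.
rewrite /bennett_bound eqxx; case: ifP => // _; case: ifP => _.
  by rewrite expr0n mulr0 mul0r oppr0 expR0.
by rewrite mul0r mul0r oppr0 expR0.
Qed.

(** Each sum in the maximum is a [part_row], whose square is at most the given product of squared
    norms. *)
Lemma half_max_eq0 (R : realType) N (A C : 'M[R]_N) :
  op_norm C ^+ 2 * frob_norm A ^+ 2 = 0 -> half_max A C = 0.
Proof.
move=> V0.
have M0 i j (s s' : 'S_N) : \sum_(k < N | (k < N./2)%N) C i (s k) * A j (s' k) = 0.
  pose B := s @: first_half N.
  have -> : \sum_(k < N | (k < N./2)%N) C i (s k) * A j (s' k) =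
      part_row A C B (s^-1 * s')%g i j.
    rewrite /part_row (big_imset _ (in2W (@perm_inj _ s)))/=.
    by apply: eq_big => [k|k _]; [rewrite inE|rewrite permM permK].
  apply/eqP; rewrite -sqrf_eq0 eq_le sqr_ge0 andbT -V0.
  apply: le_trans (sum_part_row_sqr_le A C B (s^-1 * s')).
  rewrite (bigD1 i)//= (bigD1 j)//= -addrA lerDl addr_ge0// sumr_ge0// => [k _|k _].
    exact: sqr_ge0.
  by rewrite sumr_ge0// => l _; exact: sqr_ge0.
apply: le_anti; rewrite half_max_ge0 andbT /half_max.
do 4 (apply: bigmax_le => // ? _).
by rewrite M0 normr0.
Qed.

(** A row has at most one off-diagonal entry, which then equals the row sum. *)
Lemma doubly_centered_eq0 (R : realType) N (C : 'M[R]_N) : (N <= 2)%N ->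
  doubly_centered C -> (forall i, C i i = 0) -> C = 0.
Proof.
move=> N2 dc C0; apply/matrixP => i j; rewrite mxE.
have [->//|ij] := eqVneq i j.
have [_] := dc i; rewrite (bigD1 j)//= big1 ?addr0// => k kj.
suff -> : k = i by [].
apply: val_inj; move: N2 (ltn_ord i) (ltn_ord j) (ltn_ord k).
by move: ij kj; rewrite -!val_eqE /=; lia.
Qed.

Theorem theorem1p2 (R : realType) :
  exists K : R, 0 < K /\
    forall (N : nat) (A C : 'M[R]_N)
      (d : measure_display) (T : measurableType d) (P : probability T R)
      (pi : T -> 'S_N) (t : R),
      (0 < N)%N ->
      doubly_centered C ->
      (forall i : 'I_N, C i i = 0) ->
      uniform_perm P pi ->
      0 <= t ->
      let Q := fun w : T => perm_form A C (pi w) in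
      (P [set w | t%:E <= (Q w)%:E - 'E_P[Q]] <=
        (bennett_bound K N (half_max A C)
           (op_norm C ^+ 2 * frob_norm A ^+ 2) t)%:E)%E.
Proof.
exists 256; split; first exact: ltr0Sn.
move=> N A C d T P pi t N_gt0 dc C0 piU t_ge0; set Q := fun w => _; cbv zeta.
have Ccol j : \sum_i C i j = 0 by have [] := dc j.
set nu := half_max A C; set V := op_norm C ^+ 2 * _.
have small_eq0 : (N <= 2)%N -> forall s, perm_form A C s = 0.
  move=> N2 s; rewrite (doubly_centered_eq0 N2 dc C0) /perm_form big1// => i _.
  by rewrite big1// => j _; rewrite mxE mul0r.
have EQ : ('E_P[Q] = 0)%E.
  rewrite (uniform_perm_expectation piU (perm_form A C)).
  have [N2|N2] := leqP N 2; last by rewrite sum_perm_form0// mul0r.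
  by rewrite big1 ?mul0r// => s _; exact: small_eq0.
(* As the mean is zero, the tail probability is a count of permutations divided by [N!]. *)
have -> : [set w | (t%:E <= (Q w)%:E - 'E_P[Q])%E] =
    [set w | pi w \in enum (fun s => t <= perm_form A C s)].
  by apply/seteqP; split => w /=; rewrite EQ sube0 lee_fin mem_enum.
have [_ ->] := uniform_perm_seq piU (enum_uniq (fun s => t <= perm_form A C s)).
rewrite lee_fin -cardE; set tail := _ / _.
have n_gt0 : (0 : R) < N`!%:R by rewrite ltr0n fact_gt0.
have tail_le1 : tail <= 1.
  by rewrite ler_pdivrMr// mul1r ler_nat -card_Sn max_card.
have [t0|t_neq0] := eqVneq t 0.
  by rewrite t0 bennett_bound0.
have t_gt0 : 0 < t by rewrite lt_def t_neq0.
have tail0 : (forall s, perm_form A C s = 0) -> tail = 0.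
  move=> Q0; rewrite /tail (eq_card (B := pred0)) ?card0 ?mul0r// => s.
  by rewrite !inE unfold_in Q0 leNgt t_gt0.
have bound_ge0 : 0 <= bennett_bound 256 N nu V t.
  by rewrite /bennett_bound; case: ifP => // _; case: ifP => _; rewrite expR_ge0.
have [N2|N2] := leqP N 2; first by rewrite tail0//; exact: small_eq0.
(* Here the form vanishes identically and the tail is empty for [t > 0]. This also disposes of
   [V = 0], by [half_max_eq0]. *)
have [nu0|nu_neq0] := eqVneq nu 0.
  by rewrite tail0//; exact: perm_form_eq0.
have nu_gt0 : 0 < nu by rewrite lt_def nu_neq0 half_max_ge0.
have V_neq0 : V != 0 by apply: contraNneq nu_neq0 => /half_max_eq0/eqP.
have V_gt0 : 0 < V by rewrite lt_def V_neq0 mulr_ge0 ?sqr_ge0.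
rewrite /bennett_bound (negbTE V_neq0) (negbTE nu_neq0).
have N_gt0R : (0 : R) < N%:R by rewrite ltr0n.
have [lambda l_ge0] := bennett_exponent nu_gt0 V_gt0 N_gt0R t_ge0.
rewrite -ler_expR; apply: le_trans.
rewrite expRD expRN ler_pdivlMr ?expR_gt0//.
apply: le_trans (perm_form_mgf_half_max A C0 Ccol N2 l_ge0).
(* Chernoff: each permutation in the tail contributes at least [expR (lambda * t)] to the
   exponential sum. *)
rewrite /tail mulrAC ler_pM2r ?invr_gt0// mulrC -sum1_card natr_sum mulr_sumr.
rewrite [leRHS](bigID (fun s => t <= perm_form A C s))/=.
apply: le_trans (_ : _ <= \sum_(s | t <= perm_form A C s) expR (lambda * perm_form A C s)) _.
  by apply: ler_sum => s ts; rewrite mulr1 ler_expR ler_wpM2l.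
by rewrite lerDl sumr_ge0// => s _; exact: expR_ge0.
Qed.
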